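(* Let $1\le k\le r-1$ and $1\le t\le r-1$ be integers, and let $p>1$. For all sufficiently large $n$, simultaneously for every real $c\ge0$ (that is, the threshold on $n$ does not depend on $c$), if $\mathcal{H}\subseteq\binom{[n]}{r}$ is $k$-intersecting, then $$\Phi_{c,t}(\mathcal{H})\le \Phi_{c,t}(\mathcal{S}_{n,r,k}).$$ Moreover, equality holds if and only if $\mathcal{H}$ is isomorphic to $\mathcal{S}_{n,r,k}$.
   Context: $[n]=\{1,\dots,n\}$ and $\binom{[n]}{r}$ is the collection of all $r$-subsets of $[n]$. For a family $\mathcal{H}\subseteq\binom{[n]}{r}$ and $T\subseteq[n]$, $d_{\mathcal{H}}(T)=|\{H\in\mathcal{H}:T\subseteq H\}|$. For real $c\ge 0$ and $p>0$, $$\Phi_{c,t}(\mathcal{H})=\sum_{T\in\binom{[n]}{t}}\left(c+d_{\mathcal{H}}(T)\right)^p .$$ $\mathcal{H}$ is $k$-intersecting if $|E\cap F|\ge k$ for all $E,F\in\mathcal{H}$. The full $k$-star is $\mathcal{S}_{n,r,k}=\{H\in\binom{[n]}{r}:[k]\subseteq H\}$. Two families on $[n]$ are isomorphic if a permutation of $[n]$ maps one onto the other. *)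

(* Defs.v *)
From mathcomp Require Import all_boot all_order all_fingroup all_algebra.
From mathcomp Require Import reals exp.

Set Implicit Arguments.
Unset Strict Implicit.
Unset Printing Implicit Defensive.

Import Order.TTheory GRing.Theory Num.Theory.
Local Open Scope ring_scope.

(* The ground set [n] = {1, ..., n} is represented by 'I_n = {0, ..., n-1};
   the initial segment [k] becomes [set i : 'I_n | i < k]. *)

Definition uniform (n r : nat) (H : {set {set 'I_n}}) : bool :=
  [forall A in H, #|A| == r].

Definition intersecting (n k : nat) (H : {set {set 'I_n}}) : bool :=
  [forall E in H, forall F in H, (k <= #|E :&: F|)%N].

Definition degree (n : nat) (H : {set {set 'I_n}}) (T : {set 'I_n}) : nat :=
  #|[set A in H | T \subset A]|.

Definition Phi (R : realType) (n : nat) (p c : R) (t : nat)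
    (H : {set {set 'I_n}}) : R :=
  \sum_(T : {set 'I_n} | #|T| == t) (c + (degree H T)%:R) `^ p.

Definition star (n r k : nat) : {set {set 'I_n}} :=
  [set A : {set 'I_n} | (#|A| == r) && ([set i : 'I_n | (i < k)%N] \subset A)].

Definition isomorphic (n : nat) (H G : {set {set 'I_n}}) : Prop :=
  exists s : {perm 'I_n}, [set s @: (A : {set 'I_n}) | A in H] = G.

(* Main.v *)
Require Import Defs.
From mathcomp Require Import all_boot all_order all_fingroup all_algebra.
From mathcomp Require Import reals exp.
From mathcomp Require Import ring lra zify interval_inference convex hoelder.

Set Implicit Arguments.
Unset Strict Implicit.
Unset Printing Implicit Defensive.

Import Order.TTheory GRing.Theory Num.Theory.
Local Open Scope ring_scope.

(** Let [K] be the initial segment of size [k] and [S] the full [k]-star on it.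

    If all members of [H] share [k] points, a permutation of the ground set
    carries [H] into [S].  The functional [Phi] is invariant under permutations
    and strictly increasing in the family ([Phi_imset], [Phi_proper]: a missing
    [r]-set lowers the degree of each of its [t]-subsets), so [H] is either
    isomorphic to [S] or strictly worse.

    If no [k] points are common to all members, [H] is too small to compete.
    A branching argument gives [#|H| <= r ^ k.+1 * C(n-k-1, r-k-1)]
    ([card_le_no_star]), smaller than [#|S| = C(n-k, r-k)] by a factor of order
    [n].  Hence, once [n] is large, the degrees of [H] over all [t]-sets, which
    sum to [C(r, t) * #|H|], sum to less than [#|S|].

    It remains to turn this gap between sums of degrees into a gap between sums
    of [p]-th powers, uniformly in [c].  The [t]-sets comparable with [K] for
    inclusion all have the same degree [M = C(n - max(t,k), r - max(t,k))] in
    [S].  They account for a total degree of at least [#|S|], since every member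
    of [S] contains one of them ([card_star_le_comparable]), while no degree in
    [H] exceeds [M].  The function [x |-> (c + x) `^ p] is convex, so on [0, M]
    it lies below its chord: the increment [(c + x) `^ p - c `^ p] earned by one
    unit of degree is largest at [x = M].  Thus [H], which has less total degree
    and spends it at a rate no better than that of the comparable sets of [S],
    has the smaller sum ([sum_powR_lt]).  All hypotheses of this last comparison
    concern the degrees alone, so the threshold on [n] does not involve [c]. *)

(** * Sets of prescribed size *)

Lemma card_supsets (T : finType) (D : {set T}) (r : nat) : (#|D| <= r)%N ->
  #|[set A : {set T} | (#|A| == r) && (D \subset A)]| =
  'C(#|T| - #|D|, r - #|D|).
Proof.
move=> leDr; rewrite -(cardsC D) addKn -cards_draws.
have inj : {in [set B : {set T} | B \subset ~: D & #|B| == (r - #|D|)%N] &,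
    injective (fun B => D :|: B)}.
  move=> B C; rewrite !inE -!disjoints_subset => /andP[dB _] /andP[dC _] eqBC.
  have KD (X : {set T}) : [disjoint X & D] -> (D :|: X) :\: D = X.
    by move=> dX; rewrite setDUl setDv set0U; apply/setDidPl.
  by rewrite -(KD _ dB) eqBC KD.
rewrite -(card_in_imset inj); congr #|pred_of_set _|.
apply/setP => A; rewrite inE; apply/andP/imsetP => [[/eqP cA sDA]|[B]].
  exists (A :\: D); last by rewrite setDE setUIr setUCr setIT (setUidPr sDA).
  by rewrite inE subsetDr cardsDS // cA eqxx.
rewrite inE -disjoints_subset => /andP[dB /eqP cB] ->; split; last exact: subsetUl.
have := cardsUI D B; rewrite setIC (disjoint_setI0 dB) cards0 cB.
by rewrite addn0 subnKC // => ->.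
Qed.

Lemma exists_set_between (T : finType) (D A : {set T}) (t : nat) :
    D \subset A -> (#|D| <= t <= #|A|)%N ->
  exists B : {set T}, [/\ D \subset B, B \subset A & #|B| = t].
Proof.
move=> sDA /andP[leDt letA].
have : (0 < #|[set B : {set T} | B \subset A :\: D & #|B| == (t - #|D|)%N]|)%N.
  by rewrite cards_draws bin_gt0 cardsDS // leq_sub2r.
case/card_gt0P=> B; rewrite inE subsetD => /andP[/andP[sBA dB] /eqP cB].
exists (D :|: B); rewrite subsetUl subUset sDA sBA; split=> //.
have := cardsUI D B; rewrite setIC (disjoint_setI0 dB) cards0 cB.
by rewrite addn0 subnKC.
Qed.

(** Swapping a point of [A] outside [B] with a point of [B] outside [A] brings
    [A] one point closer to [B]. *)
Lemma exists_perm_imset (T : finType) (A B : {set T}) :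
  #|A| = #|B| -> exists s : {perm T}, s @: A = B.
Proof.
have [m] := ubnP #|A :\: B|; elim: m A => // m IH A ltm eqAB.
have [/eqP|/set0Pn[x]] := eqVneq (A :\: B) set0.
  rewrite setD_eq0 => sAB; exists 1%g.
  have -> : A = B by apply/eqP; rewrite eqEcard sAB eqAB leqnn.
  rewrite -[RHS]imset_id; apply: eq_imset => x; exact: perm1.
rewrite inE => /andP[xB xA].
have /card_gt0P[y] : (0 < #|B :\: A|)%N.
  have := cardsID B A; rewrite setIC eqAB -(cardsID A B) => /addnI <-.
  by apply/card_gt0P; exists x; rewrite inE xB.
rewrite inE => /andP[yA yB].
have eqA : tperm x y @: A = y |: (A :\ x).
  apply/setP=> z; rewrite -[z in LHS](tpermK x y) mem_imset; last exact: perm_inj.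
  rewrite !inE; case: tpermP => [->|->|]; rewrite ?eqxx ?(negbTE yA) //.
  - by rewrite orbF; apply/esym/negbTE; apply: contraNneq yA => <-.
  - by move=> /eqP/negbTE-> /eqP/negbTE->.
have [||s sB] := IH (tperm x y @: A).
- rewrite -ltnS; apply: leq_trans ltm; rewrite ltnS; apply: proper_card; rewrite eqA.
  apply/properP; split.
    apply/subsetP=> z; rewrite !inE; case/andP=> zB /orP[/eqP zy|/andP[_ ->]].
      by rewrite zy yB in zB.
    by rewrite zB.
  exists x; rewrite !inE ?xB ?xA // eqxx /= orbF.
  by apply/negP => /eqP xy; rewrite -xy xA in yA.
- by rewrite card_imset //; exact: perm_inj.
exists (tperm x y * s)%g; rewrite -sB -imset_comp.
by apply: eq_imset => z; rewrite permM.
Qed.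

(** * Degrees *)

Lemma sum_degree (n : nat) (H : {set {set 'I_n}}) (P : pred {set 'I_n}) :
  (\sum_(T | P T) degree H T =
   \sum_(A in H) #|[set T : {set 'I_n} | P T && (T \subset A)]|)%N.
Proof.
transitivity (\sum_(T | P T) \sum_(A in H | T \subset A) 1)%N.
  apply: eq_bigr => T _; rewrite sum1_card /degree.
  by apply: eq_card => A; rewrite inE.
rewrite (exchange_big_dep (mem H)) /=; last by move=> T A _ /andP[].
apply: eq_bigr => A AH; rewrite sum1_card.
by apply: eq_card => T; rewrite !inE unfold_in AH.
Qed.

Lemma sum_degree_uniform (n r t : nat) (H : {set {set 'I_n}}) : uniform r H ->
  (\sum_(T : {set 'I_n} | #|T| == t) degree H T = 'C(r, t) * #|H|)%N.
Proof.
move=> /forall_inP uH; rewrite sum_degree mulnC -sum_nat_const.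
apply: eq_bigr => A /uH /eqP cA; rewrite -cA -cards_draws.
by apply: eq_card => T; rewrite !inE andbC.
Qed.

Lemma degree_le_bin (n r : nat) (H : {set {set 'I_n}}) (T : {set 'I_n}) :
  uniform r H -> (#|T| <= r)%N -> (degree H T <= 'C(n - #|T|, r - #|T|))%N.
Proof.
move=> /forall_inP uH leTr; rewrite -[n in 'C(n - _, _)]card_ord -card_supsets //.
by apply/subset_leq_card/subsetP=> A; rewrite !inE => /andP[/uH -> ->].
Qed.

Lemma degree_le_card (n : nat) (H : {set {set 'I_n}}) (T : {set 'I_n}) :
  (degree H T <= #|H|)%N.
Proof. by apply/subset_leq_card/subsetP=> A; rewrite inE => /andP[]. Qed.

Lemma degree_subset (n : nat) (H G : {set {set 'I_n}}) (T : {set 'I_n}) :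
  H \subset G -> (degree H T <= degree G T)%N.
Proof.
move=> /subsetP sHG; apply/subset_leq_card/subsetP=> A.
by rewrite !inE => /andP[/sHG -> ->].
Qed.

Lemma degree_imset (n : nat) (s : {perm 'I_n}) (H : {set {set 'I_n}})
    (T : {set 'I_n}) :
  degree [set s @: (A : {set 'I_n}) | A in H] (s @: T) = degree H T.
Proof.
have injs : injective (fun A : {set 'I_n} => s @: A).
  by apply: imset_inj; exact: perm_inj.
have subs (A : {set 'I_n}) : (s @: T \subset s @: A) = (T \subset A).
  apply/idP/idP; last exact: imsetS.
  move/subsetP=> sTA; apply/subsetP=> x xT.
  by have := sTA (s x); rewrite !mem_imset ?xT; [apply | exact: perm_inj..].
rewrite /degree -[RHS](card_imset _ injs); apply: eq_card => B; rewrite inE.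
apply/andP/imsetP => [[/imsetP[A AH ->]]|[A]].
  by rewrite subs => sTA; exists A => //; rewrite inE AH.
by rewrite inE => /andP[AH sTA] ->; rewrite subs sTA imset_f.
Qed.

(** * Families that lie in no full star are small *)

(** A set [T] with at most [k] elements meets some member [F] in fewer than [k]
    points: any member if [#|T| < k], and one that misses a point of [T] if
    [#|T| = k].  Every member containing [T] then has a point of [F] outside
    [T], so adding one of at most [r] points to [T] keeps a fraction [1/r] of
    its degree.  The induction is on the number of points still to be added to
    reach [k.+1] of them. *)
Lemma degree_le_no_star (n r k : nat) (H : {set {set 'I_n}}) :
    (k < r)%N -> uniform r H -> intersecting k H ->
    (forall K : {set 'I_n}, #|K| = k -> exists2 A, A \in H & ~~ (K \subset A)) ->
  forall (j : nat) (T : {set 'I_n}), (#|T| + j)%N = k.+1 ->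
    (degree H T <= r ^ j * 'C(n - k.+1, r - k.+1))%N.
Proof.
move=> ltkr uH /forall_inP iH nostar; elim=> [|j IH] T cT.
  by rewrite addn0 in cT; rewrite mul1n -cT degree_le_bin // cT.
rewrite /degree; set HT := [set A in H | _].
have [->|/set0Pn[E]] := eqVneq HT set0; first by rewrite cards0.
rewrite inE => /andP[EH sTE].
have [F FH ltFT] : exists2 F, F \in H & (#|F :&: T| < k)%N.
  have [ltTk|] := ltnP #|T| k; first by exists E; rewrite ?(setIidPr sTE).
  move=> lekT; have cTk : #|T| = k by lia.
  have [F FH nTF] := nostar T cTk; exists F => //.
  rewrite -cTk; apply: proper_card; rewrite properE subsetIr /=.
  by apply: contra nTF; rewrite subsetI => /andP[].
have sHT : HT \subset \bigcup_(x in F :\: T) [set A in H | x |: T \subset A].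
  apply/subsetP=> A; rewrite inE => /andP[AH sTA].
  have : ~~ (A :&: F \subset F :&: T).
    apply/negP => /subset_leq_card; have /forall_inP/(_ _ FH) := iH A AH; lia.
  case/subsetPn=> x; rewrite !inE => /andP[xA xF]; rewrite xF /= => xT.
  apply/bigcupP; exists x; first by rewrite inE xT.
  by rewrite inE AH subUset sub1set xA.
apply: leq_trans (subset_leq_card sHT) _.
apply: leq_trans (_ : _ <= \sum_(x in F :\: T) degree H (x |: T))%N _.
  rewrite /degree; elim/big_rec2: _ => [|x m B _ le]; first by rewrite cards0.
  apply: leq_trans (leq_card_setU _ _) _; exact: leq_add.
apply: leq_trans (_ : _ <= \sum_(x in F :\: T) r ^ j * 'C(n - k.+1, r - k.+1))%N _.
  apply: leq_sum => x; rewrite inE => /andP[xT _]; apply: IH.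
  by rewrite cardsU1 xT; lia.
rewrite sum_nat_const expnS -mulnA leq_mul2r; apply/orP; right.
move/forall_inP: uH => /(_ _ FH)/eqP <-; exact/subset_leq_card/subsetDl.
Qed.

Lemma card_le_no_star (n r k : nat) (H : {set {set 'I_n}}) :
    (k < r)%N -> uniform r H -> intersecting k H ->
    (forall K : {set 'I_n}, #|K| = k -> exists2 A, A \in H & ~~ (K \subset A)) ->
  (#|H| <= r ^ k.+1 * 'C(n - k.+1, r - k.+1))%N.
Proof.
move=> ltkr uH iH nostar.
have <- : degree H set0 = #|H|.
  by apply: eq_card => A; rewrite inE sub0set andbT.
by apply: degree_le_no_star; rewrite ?cards0.
Qed.

(** * The star *)

Lemma card_initial (n k : nat) : (k <= n)%N -> #|[set i : 'I_n | (i < k)%N]| = k.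
Proof.
move=> lekn; have inj : injective (widen_ord lekn).
  by move=> i j /(congr1 val) /= eqij; apply: val_inj.
rewrite -[RHS]card_ord -cardsT -(card_imset _ inj); apply: eq_card => i.
rewrite inE; apply/idP/imsetP => [ltik|[j _ ->]]; last exact: (ltn_ord j).
by exists (Ordinal ltik) => //; apply: val_inj.
Qed.

Lemma uniform_star (n r k : nat) : uniform r (star n r k).
Proof. by apply/forall_inP => A; rewrite inE => /andP[]. Qed.

Lemma card_star (n r k : nat) : (k <= r)%N -> (k <= n)%N ->
  #|star n r k| = 'C(n - k, r - k).
Proof.
by move=> lekr lekn; rewrite card_supsets ?card_initial ?card_ord.
Qed.

(** Any [T] comparable with [[k]] has maximal degree in the star, as adding
    [[k]] to [T] then yields as few points as possible. *)
Lemma degree_star_comparable (n r k t : nat) (T : {set 'I_n}) :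
    let K := [set i : 'I_n | (i < k)%N] in
    (k <= r)%N -> (t <= r)%N -> (k <= n)%N -> #|T| = t ->
    (T \subset K) || (K \subset T) ->
  degree (star n r k) T = 'C(n - maxn t k, r - maxn t k).
Proof.
move=> K lekr letr lekn cT cmp.
have cTK : #|K :|: T| = maxn t k.
  have cK : #|K| = k by rewrite card_initial.
  case/orP: cmp => s; have := subset_leq_card s; rewrite cT cK => le.
    by rewrite (setUidPl s) cK; apply/esym/maxn_idPr.
  by rewrite (setUidPr s) cT; apply/esym/maxn_idPl.
rewrite -cTK -[n in 'C(n - _, _)]card_ord -card_supsets ?cTK ?geq_max ?lekr ?letr //.
by apply: eq_card => A; rewrite !inE subUset andbA.
Qed.

(** Every member of the star contains a [t]-set comparable with [[k]], so these
    [t]-sets alone carry a total degree of at least the size of the star. *)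
Lemma card_star_le_comparable (n r k t : nat) :
    let K := [set i : 'I_n | (i < k)%N] in
    (k <= r)%N -> (t <= r)%N -> (k <= n)%N ->
  (#|star n r k| <=
   #|[set T : {set 'I_n} | (#|T| == t) && ((T \subset K) || (K \subset T))]| *
   'C(n - maxn t k, r - maxn t k))%N.
Proof.
move=> K lekr letr lekn; set J := [set T | _].
have -> : (#|J| * 'C(n - maxn t k, r - maxn t k) =
           \sum_(T | T \in J) degree (star n r k) T)%N.
  rewrite -sum_nat_const; apply: eq_bigr => T; rewrite inE => /andP[/eqP cT cmp].
  by rewrite (@degree_star_comparable n r k t).
rewrite sum_degree -sum1_card; apply: leq_sum => A.
rewrite inE => /andP[/eqP cA sKA]; apply/card_gt0P.
have cK : #|K| = k by rewrite card_initial.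
have [letk|ltkt] := leqP t k.
  have [|T [_ sTK cT]] := @exists_set_between _ set0 K t (sub0set _).
    by rewrite cards0 cK.
  by exists T; rewrite !inE cT eqxx sTK (subset_trans sTK sKA).
have [|T [sKT sTA cT]] := @exists_set_between _ K A t sKA.
  by rewrite cK cA (ltnW ltkt).
by exists T; rewrite !inE cT eqxx sKT sTA orbT.
Qed.

(** Passing from [C(n-k-1, r-k-1)] to [C(n-k, r-k)] gains a factor
    [(n-k)/(r-k)], which is at least [(n-k)/r]. *)
Lemma bin_gap (n r k c : nat) : (k < r)%N -> (r <= n)%N -> (k + r * c < n)%N ->
  (c * 'C(n - k.+1, r - k.+1) < 'C(n - k, r - k))%N.
Proof.
move=> ltkr lern ltn.
have B_gt0 : (0 < 'C(n - k.+1, r - k.+1))%N by rewrite bin_gt0 leq_sub2r.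
rewrite -(@ltn_pmul2l (r - k)) ?subn_gt0 //.
have := mul_bin_diag (n - k) (r - k.+1); rewrite -subnS -subSn // subSS => <-.
rewrite mulnA ltn_pmul2r //; apply: leq_ltn_trans (_ : r * c < n - k)%N.
  by rewrite leq_mul2r leq_subr orbT.
lia.
Qed.

(** * Sums of powers *)

Lemma powR_chord (R : realType) (p c x M : R) :
    1 <= p -> 0 <= c -> 0 <= x <= M -> 0 < M ->
  (c + x) `^ p - c `^ p <= x / M * ((c + M) `^ p - c `^ p).
Proof.
move=> p1 c0 /andP[x0 xM] M0.
have w0 : 0 <= x / M by rewrite divr_ge0 // ltW.
have w1 : x / M <= 1 by rewrite ler_pdivrMr ?mul1r.
have := @convex_powR R p p1 (Itv01 w0 w1) (c + M) c.
rewrite !classical_sets.in_setE /= !in_itv /= !andbT addr_ge0 ?(ltW M0) //.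
move=> /(_ isT c0); rewrite !convRE /= /unstable.onem.
set y := conv _ _ _; have -> : y = c + x.
  transitivity (x / M * (c + M) + (1 - x / M) * c) => //.
  by field; rewrite gt_eqF.
lra.
Qed.

(** Above [c `^ p], a term with [u i <= M] is at most [u i / M] times a term
    with [v i = M], by convexity; so [J] alone outweighs everything on the left
    as soon as [\sum_i u i < #|J| * M]. *)
Lemma sum_powR_lt (R : realType) (I : finType) (P : pred I) (J : {set I})
    (p c : R) (M : nat) (u v : I -> nat) :
    1 <= p -> 0 <= c ->
    {in J, forall i, P i /\ v i = M} -> (forall i, P i -> u i <= M)%N ->
    (\sum_(i | P i) u i < #|J| * M)%N ->
  \sum_(i | P i) (c + (u i)%:R) `^ p < \sum_(i | P i) (c + (v i)%:R) `^ p.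
Proof.
move=> p1 c0 vJ uM ltuJ.
have M0 : (0 < M)%N by case: M ltuJ {vJ uM} => //; rewrite muln0.
have p0 : 0 < p by exact: lt_le_trans p1.
pose G : R := (c + M%:R) `^ p - c `^ p.
have G0 : 0 < G.
  by rewrite subr_gt0 gt0_ltr_powR ?nnegrE ?addr_ge0 // ltrDl ltr0n.
have shift (w : I -> nat) : \sum_(i | P i) (c + (w i)%:R) `^ p =
    \sum_(i | P i) c `^ p + \sum_(i | P i) ((c + (w i)%:R) `^ p - c `^ p).
  by rewrite -big_split; apply: eq_bigr => i _ /=; rewrite addrC subrK.
rewrite (shift u) (shift v) ltrD2l.
apply: (@le_lt_trans _ _ ((\sum_(i | P i) u i)%:R / M%:R * G)).
  rewrite natr_sum !mulr_suml; apply: ler_sum => i Pi.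
  by apply: powR_chord => //; rewrite ?ltr0n // ler0n ler_nat uM.
apply: (@lt_le_trans _ _ (#|J|%:R * G)).
  by rewrite ltr_pM2r // ltr_pdivrMr ?ltr0n // -natrM ltr_nat.
rewrite [leRHS](bigID (mem J)) /= -[leLHS]addr0 lerD //.
  rewrite mulr_natl -sumr_const le_eqVlt; apply/orP; left; apply/eqP.
  apply: eq_big => [i|i /vJ[_ ->] //].
  by case: (boolP (i \in J)) => [/vJ[-> _]|]; rewrite ?andbF.
apply: sumr_ge0 => i _.
by rewrite subr_ge0 ge0_ler_powR ?nnegrE ?(ltW p0) ?addr_ge0 // lerDl.
Qed.

(** * Families inside a star *)

Lemma Phi_imset (R : realType) (n t : nat) (p c : R) (s : {perm 'I_n})
    (H : {set {set 'I_n}}) :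
  Phi p c t [set s @: (A : {set 'I_n}) | A in H] = Phi p c t H.
Proof.
have injs : injective (fun A : {set 'I_n} => s @: A).
  by apply: imset_inj; exact: perm_inj.
rewrite /Phi (reindex_inj injs) /=; apply: eq_big => [T|T _].
  by rewrite card_imset //; exact: perm_inj.
by rewrite degree_imset.
Qed.

Lemma Phi_proper (R : realType) (n r t : nat) (p c : R)
    (H G : {set {set 'I_n}}) :
    0 < p -> 0 <= c -> (t <= r)%N -> uniform r G -> H \proper G ->
  Phi p c t H < Phi p c t G.
Proof.
move=> p0 c0 letr /forall_inP uG /properP[sHG [A AG nAH]].
have [|T [_ sTA cT]] := @exists_set_between _ set0 A t (sub0set _).
  by rewrite cards0 (eqP (uG A AG)).
have nn m : c + m%:R \is Num.nneg by rewrite nnegrE addr_ge0.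
have cTt : #|T| == t by rewrite cT.
rewrite /Phi (bigD1 T) //= [ltRHS](bigD1 T) //=; apply: ltr_leD.
  rewrite gt0_ltr_powR // ltrD2l ltr_nat.
  apply: proper_card; apply/properP; split; last first.
    by exists A; rewrite !inE ?AG ?(negbTE nAH).
  by apply/subsetP=> B; rewrite !inE => /andP[/(subsetP sHG) -> ->].
apply: ler_sum => U _.
by rewrite ge0_ler_powR ?(ltW p0) // lerD2l ler_nat degree_subset.
Qed.

(** * Comparison with the star *)

Lemma Phi_lt_star_of_no_star (R : realType) (n r k t : nat) (p c : R)
    (H : {set {set 'I_n}}) :
    (k < r)%N -> (t < r)%N -> 1 <= p -> 0 <= c ->
    (k + r * ('C(r, t) * r ^ k.+1) < n)%N ->
    uniform r H -> intersecting k H ->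
    (forall K : {set 'I_n}, #|K| = k -> exists2 A, A \in H & ~~ (K \subset A)) ->
  Phi p c t H < Phi p c t (star n r k).
Proof.
move=> ltkr lttr p1 c0 ltn uH iH nostar.
have Crt_gt0 : (0 < 'C(r, t))%N by rewrite bin_gt0 ltnW.
have lern : (r <= n)%N.
  apply: leq_trans (ltnW ltn); apply: leq_trans (leq_addl _ _).
  by rewrite leq_pmulr // muln_gt0 Crt_gt0 expn_gt0 (leq_ltn_trans _ ltkr).
have lekn : (k <= n)%N by rewrite (leq_trans (ltnW ltkr)).
have ltHS : ('C(r, t) * #|H| < #|star n r k|)%N.
  rewrite card_star ?(ltnW ltkr) //.
  apply: leq_ltn_trans (bin_gap ltkr lern ltn).
  by rewrite -mulnA leq_mul2l card_le_no_star ?orbT.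
pose K := [set i : 'I_n | (i < k)%N].
pose J := [set T : {set 'I_n} | (#|T| == t) && ((T \subset K) || (K \subset T))].
apply: (@sum_powR_lt _ _ _ J _ _ 'C(n - maxn t k, r - maxn t k)) => //.
- move=> T; rewrite inE => /andP[/eqP cT cmp]; split; first by rewrite cT.
  by rewrite (@degree_star_comparable n r k t) // ltnW.
- move=> T /eqP cT; have [letk|ltkt] := leqP t k.
    (* Here [M] is the size of the star, which exceeds that of [H]. *)
    rewrite -card_star ?(ltnW ltkr) //.
    apply: leq_trans (degree_le_card _ _) _; apply: leq_trans (ltnW ltHS).
    exact: leq_pmull.
  by rewrite -cT degree_le_bin // cT ltnW.
rewrite (sum_degree_uniform _ uH); apply: leq_trans ltHS _.
by apply: card_star_le_comparable => //; exact: ltnW.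
Qed.

Lemma Phi_le_star_of_star (R : realType) (n r k t : nat) (p c : R)
    (H : {set {set 'I_n}}) (K : {set 'I_n}) :
    (t <= r)%N -> (k <= n)%N -> 0 < p -> 0 <= c ->
    uniform r H -> #|K| = k -> {in H, forall A : {set 'I_n}, K \subset A} ->
  Phi p c t H < Phi p c t (star n r k) \/ isomorphic H (star n r k).
Proof.
move=> letr lekn p0 c0 /forall_inP uH cK sKH.
have [|s sK] := @exists_perm_imset _ K [set i : 'I_n | (i < k)%N].
  by rewrite card_initial.
pose sH := [set s @: (A : {set 'I_n}) | A in H].
have sub : sH \subset star n r k.
  apply/subsetP=> _ /imsetP[A AH ->]; rewrite inE -sK imsetS ?sKH // andbT.
  by rewrite card_imset ?uH //; exact: perm_inj.
have [eqs|ne] := eqVneq sH (star n r k); first by right; exists s.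
left; rewrite -(Phi_imset _ _ _ s H).
by apply: (Phi_proper p0 c0 letr (uniform_star n r k)); rewrite properEneq ne.
Qed.

Theorem theorem1p3 (R : realType) (r k t : nat) (p : R)
    (hk : (1 <= k <= r - 1)%N) (ht : (1 <= t <= r - 1)%N) (hp : 1 < p) :
  exists n0 : nat, forall n : nat, (n0 <= n)%N ->
    forall c : R, 0 <= c ->
    forall H : {set {set 'I_n}}, uniform r H -> intersecting k H ->
      Phi p c t H <= Phi p c t (star n r k) /\
      (Phi p c t H = Phi p c t (star n r k) <-> isomorphic H (star n r k)).
Proof.
have [ltkr lttr] : (k < r)%N /\ (t < r)%N by lia.
exists (k + r * ('C(r, t) * r ^ k.+1)).+1 => n ltn c c0 H uH iH.
have p0 : 0 < p by exact: lt_trans hp.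
have lekn : (k <= n)%N by apply: leq_trans (ltnW ltn); exact: leq_addr.
have iso_eq : isomorphic H (star n r k) -> Phi p c t H = Phi p c t (star n r k).
  by case=> s <-; rewrite Phi_imset.
have : Phi p c t H < Phi p c t (star n r k) \/ isomorphic H (star n r k).
  have [/existsP[K /andP[/eqP cK /forall_inP sKH]]|] :=
      boolP [exists K : {set 'I_n}, (#|K| == k) && [forall A in H, K \subset A]].
    exact: (Phi_le_star_of_star (ltnW lttr) lekn p0 c0 uH cK sKH).
  rewrite negb_exists => /forallP nostar; left.
  apply: Phi_lt_star_of_no_star => //; first exact: ltW.
  move=> K cK; have := nostar K; rewrite cK eqxx negb_forall_in.
  by case/exists_inP=> A; exists A.
case=> [ltPhi|iso]; last by rewrite iso_eq.
split; first exact: ltW.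
by split=> // eqPhi; rewrite eqPhi ltxx in ltPhi.
Qed.
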